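(* Let $\mathsf{JL}$ be a propositional justification logic (as described in the context) whose axioms include the schemes $\mathrm{jD}$: $\neg t:\bot$ and $\mathrm{j4}$: $t:A\rightarrow !t:t:A$. Then $\mathsf{JL}(\mathsf{FP})_{\mathcal{TCS}}$ is inconsistent.
   Context: Justification terms are built from justification variables $x,y,\dots$ and justification constants $c,\dots$ using binary application $\cdot$, binary sum $+$, and, depending on the logic, unary operations $!$, $?$, $\bar{?}$. Formulas: $A::= p\mid\bot\mid\neg A\mid A\wedge A\mid A\vee A\mid A\rightarrow A\mid t:A$. The basic logic $\mathsf{J}$ has axioms: all propositional tautologies; Sum: $s:A\rightarrow(s+t):A$, $s:A\rightarrow(t+s):A$; jK: $s:(A\rightarrow B)\rightarrow(t:A\rightarrow(s\cdot t):B)$. A justification logic $\mathsf{JL}$ is obtained by adding to $\mathsf{J}$ some of: jT: $t:A\rightarrow A$; jD: $t:\bot\rightarrow\bot$ (equivalently $\neg t:\bot$); j4: $t:A\rightarrow !t:t:A$; jB: $\neg A\rightarrow\bar{?}t:\neg t:A$; j5: $\neg t:A\rightarrow ?t:\neg t:A$ (with the term operations occurring in its axioms). Rules: Modus Ponens and Iterated Axiom Necessitation (IAN): $\vdash c_{i_n}:\dots:c_{i_1}:A$ for any axiom instance $A$, any constants, $n\ge1$. The total constant specification $\mathcal{TCS}$ is the set of all formulas produced by IAN; $\mathsf{JL}_{\mathcal{CS}}$ restricts IAN to a subset $\mathcal{CS}$. Fixed point extension: $p$ is justified in $A(p,q_1,\dots,q_n)$ if every occurrence of $p$ lies in the scope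 of some $t:$. $\mathcal{L}(\mathsf{FP})$ adds an $n$-ary operator $\delta_A$ for each such formula, and $\mathsf{JL}(\mathsf{FP})$ adds to $\mathsf{JL}$ (schemes ranging over $\mathcal{L}(\mathsf{FP})$) the axioms $\delta_A(B_1,\dots,B_n)\leftrightarrow A(\delta_A(B_1,\dots,B_n),B_1,\dots,B_n)$ for all $\mathcal{L}(\mathsf{FP})$-formulas $B_i$; $\mathcal{TCS}$ for $\mathsf{JL}(\mathsf{FP})$ consists of all $c_{i_n}:\dots:c_{i_1}:A$ with $A$ an axiom instance of $\mathsf{JL}(\mathsf{FP})$. *)

(* Defs.v *)
From mathcomp Require Import all_boot.

Set Implicit Arguments.
Unset Strict Implicit.
Unset Printing Implicit Defensive.

Inductive scheme := jT | jD | j4 | jB | j5.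

(* A justification logic JL is identified with the set of its added schemes. *)
Definition jlogic := scheme -> bool.

(* The operations !, ? and \bar{?} belong to the language of JL exactly when
   the scheme in which they occur is one of its axioms. *)
Inductive term (L : jlogic) : Type :=
| Var of nat
| Const of nat
| App of term L & term L
| Sum of term L & term L
| Bang of L j4 & term L
| Quest of L j5 & term L
| QuestBar of L jB & term L.

Arguments Var {L}.
Arguments Const {L}.

(* Formulas over the terms of JL, with additional propositional operators taken
   from a signature D with arities ar. *)
Inductive form (L : jlogic) (D : Type) (ar : D -> nat) : Type :=
| Atom of nat
| Bot
| Neg of form L ar
| And of form L ar & form L ar
| Or of form L ar & form L ar
| Imp of form L ar & form L ar
| Just of term L & form L ar
| Op (d : D) of {ffun 'I_(ar d) -> form L ar}.

Arguments Atom {L D ar}.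
Arguments Bot {L D ar}.

(* The language of JL itself. *)
Definition base_form (L : jlogic) := form L (of_void nat).

Section Logic.

Variables (L : jlogic) (D : Type) (ar : D -> nat).
Local Notation form := (form L ar).

Definition Iff (A B : form) := And (Imp A B) (Imp B A).

(* Propositional variables, formulas t:A and operator applications are the
   atomic parts of a formula from the propositional point of view; v gives
   their truth values (its values on other formulas are not used). *)
Fixpoint truth (v : form -> bool) (A : form) : bool :=
  match A with
  | Bot => false
  | Neg B => ~~ truth v B
  | And B C => truth v B && truth v C
  | Or B C => truth v B || truth v C
  | Imp B C => truth v B ==> truth v C
  | Atom _ | Just _ _ | Op _ _ => v A
  end.

Definition tautology (A : form) : Prop := forall v, truth v A.

Inductive JL_axiom : form -> Prop :=
| ax_taut A of tautology A : JL_axiom A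
| ax_suml s t A : JL_axiom (Imp (Just s A) (Just (Sum s t) A))
| ax_sumr s t A : JL_axiom (Imp (Just s A) (Just (Sum t s) A))
| ax_jK s t A B :
    JL_axiom (Imp (Just s (Imp A B)) (Imp (Just t A) (Just (App s t) B)))
| ax_jT t A of L jT : JL_axiom (Imp (Just t A) A)
| ax_jD t of L jD : JL_axiom (Neg (Just t Bot))
| ax_j4 t A (h : L j4) : JL_axiom (Imp (Just t A) (Just (Bang h t) (Just t A)))
| ax_jB t A (h : L jB) :
    JL_axiom (Imp (Neg A) (Just (QuestBar h t) (Neg (Just t A))))
| ax_j5 t A (h : L j5) :
    JL_axiom (Imp (Neg (Just t A)) (Just (Quest h t) (Neg (Just t A)))).

(* just_consts [:: c_n; ...; c_1] A is c_n : ... : c_1 : A. *)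
Definition just_consts (cs : seq nat) (A : form) : form :=
  foldr (fun c => Just (Const c)) A cs.

Definition TCS (axiom : form -> Prop) (F : form) : Prop :=
  exists (cs : seq nat) (A : form),
    [/\ (0 < size cs)%N, axiom A & F = just_consts cs A].

(* Theorems of the system with the given axioms, Modus Ponens, and IAN
   restricted to the constant specification CS. *)
Inductive provable (axiom CS : form -> Prop) : form -> Prop :=
| pr_axiom A of axiom A : provable axiom CS A
| pr_IAN A of CS A : provable axiom CS A
| pr_MP A B of provable axiom CS (Imp A B) & provable axiom CS A :
    provable axiom CS B.

Definition inconsistent (axiom CS : form -> Prop) : Prop :=
  provable axiom CS Bot.

End Logic.

(* Every occurrence of p in A lies in the scope of some t: . *)
Fixpoint justified (L : jlogic) (p : nat) (A : base_form L) : bool :=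
  match A with
  | Atom q => q != p
  | Bot => true
  | Neg B => justified p B
  | And B C | Or B C | Imp B C => justified p B && justified p C
  | Just _ _ => true
  | Op d _ => match d with end
  end.

Fixpoint atoms (L : jlogic) (A : base_form L) : seq nat :=
  match A with
  | Atom q => [:: q]
  | Bot => [::]
  | Neg B => atoms B
  | And B C | Or B C | Imp B C => atoms B ++ atoms C
  | Just _ B => atoms B
  | Op d _ => match d with end
  end.

(* The index A(p, q_1, ..., q_n) of a fixed point operator: a formula of the
   language of JL with its distinguished p and its list of parameters. *)
Record fpop (L : jlogic) := Fpop {
  fp_body : base_form L;
  fp_var : nat;
  fp_params : seq nat;
  fp_uniq : uniq (fp_var :: fp_params);
  fp_atoms : all (fun q => q \in fp_var :: fp_params) (atoms fp_body);
  fp_justified : justified fp_var fp_body }.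

Definition fp_arity (L : jlogic) (d : fpop L) : nat := size (fp_params d).

Definition fp_form (L : jlogic) := form L (@fp_arity L).

Fixpoint subst (L : jlogic) (D : Type) (ar : D -> nat) (s : nat -> form L ar)
    (A : base_form L) : form L ar :=
  match A with
  | Atom q => s q
  | Bot => Bot
  | Neg B => Neg (subst s B)
  | And B C => And (subst s B) (subst s C)
  | Or B C => Or (subst s B) (subst s C)
  | Imp B C => Imp (subst s B) (subst s C)
  | Just t B => Just t (subst s B)
  | Op d _ => match d with end
  end.

Definition delta (L : jlogic) (d : fpop L)
    (B : {ffun 'I_(fp_arity d) -> fp_form L}) : fp_form L :=
  @Op L (fpop L) (@fp_arity L) d B.

(* A(C, B_1, ..., B_n) for d = A(p, q_1, ..., q_n); by fp_atoms, the last
   branch of the substitution is never reached. *)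
Definition fp_instance (L : jlogic) (d : fpop L) (C : fp_form L)
    (B : {ffun 'I_(fp_arity d) -> fp_form L}) : fp_form L :=
  subst (fun q => if q == fp_var d then C
                  else if insub (index q (fp_params d)) is Some i then B i
                  else Atom q)
        (fp_body d).

Inductive JLFP_axiom (L : jlogic) : fp_form L -> Prop :=
| ax_JL A of JL_axiom A : JLFP_axiom A
| ax_FP (d : fpop L) (B : {ffun 'I_(fp_arity d) -> fp_form L}) :
    JLFP_axiom (Iff (delta B) (fp_instance (delta B) B)).

(* Main.v *)
(** The fixed point [d <-> ~ r:d] is contradictory as soon as [r] justifies
    [d]. As in the modal logic D4, [d] is provable: [r:d] yields both
    [!r:r:d] and a justification of [~ r:d], hence a justification of [Bot].
    Internalizing this derivation with the total constant specification gives
    a term justifying [d]. A leaf of the derivation, whatever terms it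
    mentions, is justified by a constant, so that the term obtained records
    only the shape of the derivation and does not depend on [r]. Therefore it
    can be chosen as [r] before the fixed point is formed. *)
Require Import Defs.
From mathcomp Require Import all_boot.

Set Implicit Arguments.
Unset Strict Implicit.
Unset Printing Implicit Defensive.

Section Internalization.

Variables (L : jlogic) (D : Type) (ar : D -> nat) (axiom : form L ar -> Prop).

Local Notation "|- A" := (provable axiom (TCS axiom) A) (at level 70).
Local Notation c := (Const 0).

Hypothesis axiom_JL : forall A, JL_axiom A -> axiom A.

Definition internalized (u : term L) (A : form L ar) : Prop :=
  |- A /\ |- Just u A.

Lemma internalized_axiom A : axiom A -> internalized c A.
Proof.
move=> axA; split; first exact: pr_axiom.
by apply: pr_IAN; exists [:: 0], A.
Qed.

Lemma internalized_JL A : JL_axiom A -> internalized c A.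
Proof. by move=> axA; apply/internalized_axiom/axiom_JL. Qed.

(** The premises [c:A] of a jK instance must themselves be justified before they can be detached;
    IAN of length two supplies [c:c:A]. *)
Lemma internalized_const A : axiom A -> internalized c (Just c A).
Proof.
by move=> axA; split; apply: pr_IAN; [exists [:: 0], A | exists [:: 0; 0], A].
Qed.

Lemma internalized_MP u v A B :
  internalized u (Imp A B) -> internalized v A -> internalized (App u v) B.
Proof.
move=> [AB uAB] [pA vA]; split; first exact: pr_MP AB pA.
apply: pr_MP vA; apply: pr_MP uAB.
by apply/pr_axiom/axiom_JL/ax_jK.
Qed.

(* The shape of the derivation in [internalized_liar]. *)
Definition liar_term : term L :=
  App (App (App (App (App c (App c (App (App c c) c))) c) c) c) c.

Lemma internalized_liar (r : term L) (d : form L ar) :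
    (forall v, truth v d = v d) -> L jD -> L j4 ->
  axiom (Iff d (Neg (Just r d))) -> internalized liar_term d.
Proof.
move=> d_atomic hjD hj4 ax_d; set N := Just r d.
have ax_contra : axiom (Imp (Iff d (Neg N)) (Imp d (Imp N Bot))).
  by apply/axiom_JL/ax_taut => v /=; rewrite d_atomic; case: (v d) (v N) => [] [].
(* The equivalence for [d] turns a justification of [d] into one of [~N], written [N -> Bot] so that
   jK applies to it. *)
have jW : internalized (App c (App (App c c) c))
    (Imp N (Just (App (App c c) r) (Imp N Bot))).
  apply: internalized_MP (internalized_JL (ax_jK _ _ _ _)) _.
  apply: internalized_MP (internalized_const ax_d).
  apply: internalized_MP (internalized_const ax_contra).
  exact: internalized_JL (ax_jK _ _ _ _).
have jX := internalized_JL (ax_jK (App (App c c) r) (Bang hj4 r) N Bot).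
have jB := internalized_JL (ax_j4 r d hj4).
have jnX := internalized_JL
  (@ax_jD L D ar (App (App (App c c) r) (Bang hj4 r)) hjD).
apply: internalized_MP (internalized_axiom ax_d).
apply: internalized_MP jnX; apply: internalized_MP jB.
apply: internalized_MP jX; apply: internalized_MP jW.
(* By the first three premises [N] yields a justification of [Bot], against jD; hence [~N], that is
   [d]. *)
apply/internalized_JL/ax_taut => v /=; rewrite d_atomic -/N.
by case: (v d); case: (v N); case: (v _); case: (v _); case: (v _).
Qed.

Lemma inconsistent_liar (d : form L ar) :
    (forall v, truth v d = v d) -> L jD -> L j4 ->
  axiom (Iff d (Neg (Just liar_term d))) -> inconsistent axiom (TCS axiom).
Proof.
move=> d_atomic hjD hj4 ax_d.
have [pd pjd] := internalized_liar d_atomic hjD hj4 ax_d.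
apply: pr_MP pjd; apply: pr_MP pd; apply: pr_MP (pr_axiom _ ax_d).
apply/pr_axiom/axiom_JL/ax_taut => v /=; rewrite d_atomic.
by case: (v d); case: (v _).
Qed.

End Internalization.

Definition liar_fpop (L : jlogic) : fpop L :=
  @Fpop L (Neg (Just (liar_term L) (Atom 0))) 0 [::] isT isT isT.

Theorem theorem19 (L : jlogic) (hjD : L jD) (hj4 : L j4) :
  inconsistent (@JLFP_axiom L) (TCS (@JLFP_axiom L)).
Proof.
(* The operator is nullary: [Bot] is only a filler. *)
pose B : {ffun 'I_(fp_arity (liar_fpop L)) -> fp_form L} := [ffun=> Bot].
apply: (@inconsistent_liar _ _ _ _ (@ax_JL L) (delta B)) => //.
exact: (ax_FP B).
Qed.
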